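(* Let $P$ be a problem whose optimal solution value is $\mathcal{O} \in (0,1]$. Let $\mathcal{A}$ be a one-pass streaming algorithm that, for a parameter $\epsilon \in (0,1)$, gives an $\epsilon$-additive solution to $P$ using space $S(\epsilon)$. Then one can design an $O\left(\log\left(\frac{1}{\mathcal{O}}\right)\right)$-pass streaming algorithm $\mathcal{A}'$ that gives an $\epsilon$-multiplicative solution to $P$ and uses space $S(\epsilon \cdot \mathcal{O})$.
   Context: A streaming algorithm reads its input, a sequence of data items, in order, in one pass or in several passes ($p$-pass: the stream is read $p$ times), and keeps in memory only a sketch; its space is the size of that memory. For a problem $P$ with optimal solution value $\mathcal{O}$ on the given input, and an algorithm output $\mathcal{O}'$, the output is an $\epsilon$-additive solution if $|\mathcal{O}'-\mathcal{O}| \le \epsilon$, and an $\epsilon$-multiplicative solution if $|\mathcal{O}'-\mathcal{O}| \le \epsilon\, \mathcal{O}$.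
   Formalization: The space bound is S(c·ε·O) for a universal constant c in (0,1] instead of S(ε·O), which fails literally; the pass number is not charged to space, and O(log(1/O)) passes is read as at most C(1+ln(1/O)). *)

(* Defs.v *)
From HB Require Import structures.
From mathcomp Require Import all_boot all_order all_algebra.
From mathcomp Require Import reals exp.

Set Implicit Arguments.
Unset Strict Implicit.
Unset Printing Implicit Defensive.

Import Order.TTheory GRing.Theory Num.Theory.
Local Open Scope ring_scope.

(* [opt] is meaningful only on the streams selected by [instance]. *)
Record problem (R : realType) (item : Type) := Problem {
  instance : seq item -> Prop;
  opt : seq item -> R
}.

(* The sketch is a word over the alphabet [cell] ([bool] for bits), and its
   size is its length. At the end of a pass, [finish] either halts with an
   output ([inl]) or starts one more pass with the given sketch ([inr]).
   The index of the current pass, counted from 0, is control information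
   available to [step] and [finish]; it is not part of the sketch.
   As in non-uniform models, the transition functions are arbitrary. *)
Record algorithm (R : realType) (item cell : Type) := Algorithm {
  init : seq cell;
  step : nat -> seq cell -> item -> seq cell;
  finish : nat -> seq cell -> R + seq cell
}.

Section Semantics.
Variables (R : realType) (item cell : Type).
Variables (A : algorithm R item cell) (s : seq item).

Definition pass_end (i : nat) (m : seq cell) : seq cell :=
  foldl (step A i) m s.

(* The maximum is over the sketch before the first item and after each one. *)
Definition pass_space (i : nat) (m : seq cell) : nat :=
  (\max_(m' <- m :: scanl (step A i) m s) size m')%N.

(* [runs_from i m p k v]: started at pass number [i] with sketch [m], [A]
   makes exactly [p] passes over [s], [k] is the maximal size of its sketch,
   and [v] is its output. *)
Inductive runs_from : nat -> seq cell -> nat -> nat -> R -> Prop :=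
| run_halt i m v :
    finish A i (pass_end i m) = inl v ->
    runs_from i m 1 (pass_space i m) v
| run_again i m m' p k v :
    finish A i (pass_end i m) = inr m' ->
    runs_from i.+1 m' p k v ->
    runs_from i m p.+1 (maxn (pass_space i m) k) v.

Definition runs (p k : nat) (v : R) : Prop := runs_from 0 (init A) p k v.

End Semantics.

Definition additive_solution (R : realType) (eps o o' : R) : Prop :=
  `|o' - o| <= eps.

Definition multiplicative_solution (R : realType) (eps o o' : R) : Prop :=
  `|o' - o| <= eps * o.

(* Main.v *)
(* Pass number [i] runs the additive algorithm with accuracy
   [e_i = eps * 2^-i / 3] and halts as soon as its output is at least
   [2/3 * 2^-i].  On halting the optimum [o] is at least [2^-i / 3], so the
   error [e_i] is at most [eps * o]; and halting is certain once
   [2^-i <= o], which happens at some [i] with [o / 2 < 2^-i].  Hence there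
   are at most [2 + log_2 (1/o)] passes, with accuracies at least
   [eps * o / 6].

   The space bound [S] need not be monotone.  Each accuracy [e] is therefore
   first replaced by a point of ]0, e] where the integer part of [S] is
   minimal: space being an integer, running there is within the bound [S e']
   for every [e' <= e]. *)
Require Import Defs.
From HB Require Import structures.
From mathcomp Require Import all_boot all_order all_algebra.
From mathcomp Require Import boolp reals exp.
From mathcomp Require Import lra.

Set Implicit Arguments.
Unset Strict Implicit.
Unset Printing Implicit Defensive.

Import Order.TTheory GRing.Theory Num.Theory.
Local Open Scope ring_scope.

(** The least [i] with [2^-1 ^+ i <= x] works: the preceding power exceeds [x], and for [i = 0] the
    bound [x <= 1] suffices. *)
Lemma dyadic_bracket (R : realType) (x : R) : 0 < x <= 1 ->
  exists i : nat, x / 2 < 2^-1 ^+ i <= x.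
Proof.
move=> /andP[x0 x1].
have ex : exists i : nat, 2^-1 ^+ i <= x.
  exists (Num.bound x^-1).
  rewrite exprVn -[leRHS]invrK lef_pV2 ?posrE ?exprn_gt0 ?invr_gt0 //.
  apply/ltW/(lt_trans (archi_boundP _)); first by rewrite invr_ge0 ltW.
  by rewrite -natrX ltr_nat ltn_expl.
have [[|i] ix imin] := ex_minnP ex.
  by exists 0%N; rewrite ix andbT expr0; lra.
exists i.+1; rewrite ix andbT exprS.
have : x < 2^-1 ^+ i by rewrite ltNge; apply/negP => /imin; rewrite ltnn.
lra.
Qed.

(** Logarithms of [2 ^ i <= 2 / x] give [i <= 1 + ln (1 / x) / ln 2]. The count is [i.+1] since
    passes are numbered from 0; the factor covers both the constant 2 and the slope [(ln 2)^-1]. *)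
Lemma dyadic_ln_bound (R : realType) (x : R) (i : nat) :
  0 < x <= 1 -> x / 2 < 2^-1 ^+ i ->
  i.+1%:R <= (2 + (ln 2)^-1) * (1 + ln (1 / x)).
Proof.
move=> /andP[x0 x1] ix; rewrite div1r.
have ln2 : 0 < ln 2 :> R by rewrite ln_gt0 // ltr1n.
have L0 : i%:R * ln 2 <= ln 2 + ln x^-1.
  rewrite mulr_natl -lnXn ?ltr0n // -lnM ?posrE ?invr_gt0 ?ltr0n //.
  rewrite ler_ln ?posrE ?exprn_gt0 ?mulr_gt0 ?invr_gt0 //.
  rewrite -[leLHS]invrK -exprVn -[leRHS]invrK invf_div.
  by rewrite lef_pV2 ?posrE ?exprn_gt0 ?divr_gt0 ?invr_gt0 // ltW.
have {}L0 : i%:R <= 1 + (ln 2)^-1 * ln x^-1.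
  by rewrite -(ler_pM2r ln2) mulrDl mul1r mulrAC mulVf ?gt_eqF // mul1r.
rewrite -[i.+1%:R]natr1.
have t0 : 0 < (ln 2)^-1 :> R by rewrite invr_gt0.
have : 0 <= ln x^-1 by rewrite ln_ge0 // invf_ge1.
lra.
Qed.

Lemma monotone_accuracy (R : realType) (S : R -> R) :
  exists eta : R -> R, forall e : R, 0 < e ->
    0 < eta e <= e /\
    forall (k : nat) (e' : R), k%:R <= S (eta e) -> 0 < e' <= e -> 0 <= S e' ->
      k%:R <= S e'.
Proof.
suff /choice[eta etaP] : forall e : R, exists d : R, 0 < e -> 0 < d <= e /\
    forall (k : nat) (e' : R), k%:R <= S d -> 0 < e' <= e -> 0 <= S e' ->
      k%:R <= S e' by exists eta.
move=> e.
have [e0|] := boolP (0 < e); last by exists 0.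
(* [S] may attain no minimum on ]0, e], but its truncations are naturals, so a least one is
   attained. *)
pose attained n := `[< exists2 d : R, 0 < d <= e & Num.truncn (S d) = n >].
have ex : exists n, attained n.
  by exists (Num.truncn (S e)); apply/asboolP; exists e; rewrite ?e0 ?lexx.
have [n /asboolP[d de <-] dmin] := ex_minnP ex.
exists d => _; split=> // k e' kd e'e Se'.
rewrite -truncn_ge_nat //; apply: (@leq_trans (Num.truncn (S d))).
  by rewrite truncn_ge_nat // (le_trans _ kd).
by apply: dmin; apply/asboolP; exists e'.
Qed.

(** [run_again] would leave a run of zero passes, whereas every run makes at least one. *)
Lemma runs1_inv (R : realType) (item cell : Type) (A : algorithm R item cell)
    (s : seq item) (k : nat) (v : R) :
  runs A s 1%N k v ->
  finish A 0%N (pass_end A s 0%N (init A)) = inl v /\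
  k = pass_space A s 0%N (init A).
Proof.
rewrite /runs; move: (init A) => m.
move Ep : 1%N => p; move Ei : 0%N => i run.
case: run Ep => [//|j m1 m2 q l w _ run [q0]].
by case: run q0.
Qed.

(** Pass [i] imitates pass 0 of [B i] from a fresh sketch; [i] is read off the pass index, so it
    takes no space. *)
Definition restart (R : realType) (item cell : Type)
    (B : nat -> algorithm R item cell) (stop : nat -> R -> bool) :
    algorithm R item cell :=
  Algorithm (init (B 0%N)) (fun i => step (B i) 0%N)
    (fun i m => match finish (B i) 0%N m with
                | inl v => if stop i v then inl v else inr (init (B i.+1))
                | inr m' => inr m'
                end).

Lemma restart_runs (R : realType) (item cell : Type)
    (B : nat -> algorithm R item cell) (stop : nat -> R -> bool)
    (s : seq item) (n K : nat) (Q : nat -> R -> Prop) :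
  (forall i, (i <= n)%N -> exists k v,
    [/\ runs (B i) s 1%N k v, (k <= K)%N & Q i v]) ->
  (forall v, Q n v -> stop n v) ->
  exists i p k v, [/\ runs (restart B stop) s p k v, (p <= n.+1)%N, (k <= K)%N,
    Q i v & stop i v].
Proof.
move=> sub_run stop_last.
(* Every pass starts afresh from [init (B i)], so an induction on the number [d] of passes left
   after pass [i] needs no history. *)
suff from_pass d i : (i + d = n)%N -> exists j p k v,
    [/\ runs_from (restart B stop) s i (init (B i)) p k v, (p <= d.+1)%N,
      (k <= K)%N, Q j v & stop j v] by exact: (from_pass n 0%N).
elim/ltn_ind: d i => d IH i Ein.
have [v [fin kK Qv]] : exists v,
    [/\ finish (B i) 0%N (pass_end (B i) s 0%N (init (B i))) = inl v,
      (pass_space (B i) s 0%N (init (B i)) <= K)%N & Q i v].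
  have [|k [v [/runs1_inv[fin <-] kK Qv]]] := sub_run i.
    by rewrite -Ein leq_addr.
  by exists v.
have [stop_i|go_on] := boolP (stop i v).
  exists i, 1%N, (pass_space (B i) s 0%N (init (B i))), v; split=> //.
  by apply: run_halt; rewrite /= [finish _ _ _]fin stop_i.
(* For [d = 0] the pass is number [n], where [stop_last] forces a halt. *)
case: d IH Ein => [_ Ein|d IH Ein].
  by rewrite -[i]addn0 Ein stop_last // -Ein addn0 in go_on.
have [|j [p [k [w [run pd kK' Qw stop_j]]]]] := IH d (ltnSn d) i.+1.
  by rewrite addSnnS.
exists j, p.+1, (maxn (pass_space (B i) s 0%N (init (B i))) k), w.
split=> //; last by rewrite geq_max kK.
by apply: run_again run; rewrite /= [finish _ _ _]fin (negbTE go_on).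
Qed.

Theorem theorem1 (R : realType) :
  exists C c : R, [/\ 0 < C, 0 < c, c <= 1 &
    forall (item cell : Type) (P : problem R item)
        (A : R -> algorithm R item cell) (S : R -> R),
      (forall s, instance P s -> 0 < opt P s <= 1) ->
      (forall eps : R, 0 < eps < 1 -> forall s, instance P s ->
         exists k v,
           [/\ runs (A eps) s 1 k v,
               k%:R <= S eps &
               additive_solution eps (opt P s) v]) ->
      exists A' : R -> algorithm R item cell,
        forall eps : R, 0 < eps < 1 -> forall s, instance P s ->
          exists p k v,
            [/\ runs (A' eps) s p k v,
                p%:R <= C * (1 + ln (1 / opt P s)),
                k%:R <= S (c * (eps * opt P s)) &
                multiplicative_solution eps (opt P s) v]].
Proof.
have ln2 : 0 < ln 2 :> R by rewrite ln_gt0 // ltr1n.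
(* The factor 1/6 is the 1/3 in [acc] times the 1/2 lost in [dyadic_bracket]. *)
exists (2 + (ln 2)^-1), 6^-1; split; [|lra..|].
  by rewrite addr_gt0 // ?invr_gt0.
move=> item cell P A S opt01 A_sol; have [eta etaP] := monotone_accuracy S.
pose acc eps i : R := eps * 2^-1 ^+ i / 3.
pose stop i (v : R) := 2 / 3 * 2^-1 ^+ i <= v.
(* Neither the accuracies nor the halting test may mention [opt P s], which is unknown to the
   algorithm. *)
exists (fun eps => restart (fun i => A (eta (acc eps i))) stop).
move=> eps eps01 s Ps.
have [o0 o1] := andP (opt01 s Ps); have [e0 e1] := andP eps01.
have [n /andP[on no]] := dyadic_bracket (opt01 s Ps).
set o := opt P s in o0 o1 on no *.
set e' := 6^-1 * (eps * o).
have eo_gt0 : 0 < eps * o by rewrite mulr_gt0.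
have eo_lt1 : eps * o < 1 by rewrite (le_lt_trans _ e1) // ler_piMr // ltW.
(* A run at accuracy [e'] exists, and its size is a natural number below [S e']. *)
have S_ge0 : 0 <= S e'.
  have [|k [v [_ kS _]]] := A_sol e' _ s Ps; first by rewrite /e'; lra.
  exact: le_trans kS.
have acc_n i : (i <= n)%N -> e' <= acc eps i.
  move=> le_in; rewrite /e' /acc.
  have : 2^-1 ^+ n <= 2^-1 ^+ i :> R by rewrite ler_wiXn2l //; lra.
  move=> ni; have : eps * (o / 2) <= eps * 2^-1 ^+ i.
    by rewrite ler_pM2l // ltW // (lt_le_trans on).
  lra.
have pow_gt0 i : 0 < 2^-1 ^+ i :> R by rewrite exprn_gt0 // invr_gt0.
have pow_le1 i : 2^-1 ^+ i <= 1 :> R by rewrite exprn_ile1 //; lra.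
have acc01 i : 0 < acc eps i < 1.
  have := mulr_gt0 e0 (pow_gt0 i).
  have : eps * 2^-1 ^+ i <= eps by rewrite ler_piMr // ltW.
  rewrite /acc; lra.
have [||i [p [k [v [run pn kK err stop_i]]]]] := @restart_runs R item cell
  (fun i => A (eta (acc eps i))) stop s n (Num.truncn (S e'))
  (fun i v => `|v - o| <= acc eps i).
- move=> i le_in; have [a0 a1] := andP (acc01 i).
  have [/andP[d0 da] dmin] := etaP _ a0.
  have [|k [v [run kS err]]] := A_sol (eta (acc eps i)) _ s Ps.
    by rewrite d0 (le_lt_trans da).
  exists k, v; split=> //; last exact: le_trans da.
  rewrite truncn_ge_nat //; apply: dmin => //.
  by rewrite acc_n // mulr_gt0 // invr_gt0.
(* Here [v >= o - 2^-n / 3 >= 2/3 * 2^-n], by [eps < 1] and [2^-n <= o]. *)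
- move=> v; rewrite ler_distl /stop /acc => /andP[ov _].
  have : eps * 2^-1 ^+ n <= 2^-1 ^+ n by rewrite ler_piMl // ltW.
  lra.
exists p, k, v; split=> //.
- by apply: le_trans (dyadic_ln_bound (opt01 s Ps) on); rewrite ler_nat.
- by rewrite -truncn_ge_nat.
(* After cancelling [eps] it remains that [2^-i / 3 <= o], from
   [2/3 * 2^-i <= v <= o + 2^-i / 3]. *)
- rewrite /multiplicative_solution (le_trans err) // /acc -mulrA ler_pM2l //.
  move: err stop_i; rewrite ler_distl /stop /acc => /andP[_ vo].
  have : eps * 2^-1 ^+ i <= 2^-1 ^+ i by rewrite ler_piMl // ltW.
  lra.
Qed.
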